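(* Let $\Sigma=\{a,b\}$ and let $w\in\Sigma^{*}$ be a nonempty word of length $|w|=n$. Then there exists a strongly connected synchronizing deterministic finite automaton $\mathscr{B}$ over $\Sigma$ with exactly $n+1$ states such that $\mathrm{Syn}(\mathscr{B})=\Sigma^{*}w\Sigma^{*}$.
   Context: A deterministic finite automaton (DFA) here is a triple $\mathscr{A}=\langle Q,\Sigma,\delta\rangle$ with finite nonempty state set $Q$, finite input alphabet $\Sigma$ and a total transition function $\delta:Q\times\Sigma\to Q$, extended to $Q\times\Sigma^{*}\to Q$ in the natural way (no initial or final states). It is synchronizing if there is a word $w\in\Sigma^{*}$ with $\delta(q,w)=\delta(q',w)$ for all $q,q'\in Q$; such a $w$ is called a synchronizing word, and $\mathrm{Syn}(\mathscr{A})$ denotes the set of all synchronizing words of $\mathscr{A}$. The automaton is strongly connected if for any two distinct states $p,q$ there is a word $u$ with $\delta(p,u)=q$. *)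

(* Defs.v *)
From HB Require Import structures.
From mathcomp Require Import all_boot.

Set Implicit Arguments.
Unset Strict Implicit.
Unset Printing Implicit Defensive.

(* Automata without initial or final states; totality of the transition
   function is built into the type of [trans]. *)
Record dfa (Sigma : finType) := Dfa {
  state : finType;
  trans : state -> Sigma -> state;
  state_nonempty : 0 < #|state| }.

Section Synchronization.
Variables (Sigma : finType) (A : dfa Sigma).

(* Words are read from left to right. *)
Definition run (q : state A) (u : seq Sigma) : state A := foldl (@trans _ A) q u.

Definition Syn : pred (seq Sigma) :=
  [pred u | [forall q, forall q', run q u == run q' u]].

Definition synchronizing : Prop := exists u : seq Sigma, u \in Syn.

Definition strongly_connected : Prop :=
  forall p q : state A, p != q -> exists u : seq Sigma, run p u = q.

End Synchronization.

(* Main.v *)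
Require Import Defs.
From HB Require Import structures.
From mathcomp Require Import all_boot.

(** Write p_i for the prefix of w of length i. The states 0, ..., n are the
    vertices of a tree whose n edges e_0, ..., e_(n-1) are the non-final states
    of the minimal automaton of the ideal generated by w (the matching automaton
    on proper prefixes of w): every letter maps e_k to the edge prescribed by
    that automaton, and the last letter of w collapses e_(n-1). Hence a word
    collapses e_0 exactly when it contains w, and w collapses every edge, so it
    synchronizes the tree.

    Vertex i + 1 stands for p_i and vertex 0 for "no prefix". A tree is
    bipartite, and every letter is made to exchange the two colours. The vertex
    reached after u from either end of e_0 = {0, 1} is then the longest p_i,
    i < n, that is a suffix of u and whose length has the parity required by the
    colour. With this choice, any letter that does not prolong p_i sends the
    vertex i + 1 to a smaller one, which gives strong connectivity. *)

Lemma suffix_of_suffixes (T : eqType) (s1 s2 u : seq T) :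
  suffix s1 u -> suffix s2 u -> size s1 <= size s2 -> suffix s1 s2.
Proof.
move=> s1u s2u le12; have le2 := size_suffix s2u.
move: s1u s2u; rewrite !suffixE => /eqP E1 /eqP <-.
by rewrite size_drop subKn // drop_drop addnC addnBA // subnK // E1.
Qed.

Section Construction.
Variables (Sigma : finType) (w : seq Sigma).
Hypothesis w_neq0 : w != [::].
Local Notation n := (size w).

(** The empty maximum is 0; the shift to [i.+1] keeps the empty prefix apart from it. *)
Definition border_state (u : seq Sigma) (e : bool) : nat :=
  \max_(i < n | suffix (take i w) u && (odd i == e)) i.+1.

(** By truncated predecessor, 0 and 1, the two ends of e_0, share the empty label. *)
Definition label (v : nat) : seq Sigma := take v.-1 w.

Lemma size_gt0 : 0 < n. Proof. by rewrite lt0n size_eq0. Qed.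

Lemma border_state_le u e : border_state u e <= n.
Proof. by apply/bigmax_leqP => i _. Qed.

Lemma border_state_gt u i :
  i < n -> suffix (take i w) u -> i < border_state u (odd i).
Proof.
move=> lt_in su.
apply: (@leq_bigmax_cond _ _ (fun j : 'I_n => j.+1) (Ordinal lt_in)).
by rewrite /= su eqxx.
Qed.

Variant border_state_spec (u : seq Sigma) (e : bool) : nat -> Prop :=
  | BorderNone of e : border_state_spec u e 0
  | BorderSome i of i < n & suffix (take i w) u & odd i = e :
      border_state_spec u e i.+1.

Lemma border_stateP u e : border_state_spec u e (border_state u e).
Proof.
have: border_state u e = 0 \/
    exists i, [/\ border_state u e = i.+1, i < n, suffix (take i w) u & odd i = e].
  rewrite /border_state; elim/big_ind: _ => [|x y Hx Hy|i /andP[si /eqP oi]].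
  - by left.
  - by case: leqP.
  - by right; exists (i : nat).
case=> [e0|[i [-> lt_in si oi]]]; last exact: BorderSome.
(* For even parity the empty prefix is always a candidate, which excludes the value 0. *)
rewrite e0; constructor; case: e e0 => // e0.
by have := border_state_gt u 0 size_gt0; rewrite take0 suffix0s e0 => /(_ isT).
Qed.

Lemma odd_border_state u e : odd (border_state u e) = ~~ e.
Proof. by case: border_stateP => [->|i _ _ <-]. Qed.

Lemma suffix_label_border_state u e : suffix (label (border_state u e)) u.
Proof. by case: border_stateP => [_|i _ si _]; rewrite /label ?take0 ?suffix0s. Qed.

Lemma border_state_label v : v <= n -> border_state (label v) (~~ odd v) = v.
Proof.
case: v => [_|v lt_vn].
  case: border_stateP => // i lt_in; rewrite /label take0 suffixs0 -size_eq0.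
  by rewrite size_takel ?(ltnW lt_in) // => /eqP->.
rewrite /= negbK; apply/eqP; rewrite eqn_leq border_state_gt ?suffix_refl // andbT.
case: border_stateP => // i lt_in /size_suffix.
by rewrite !size_takel // ltnW.
Qed.

(* The left-hand side is the parent of [v] in the tree. *)
Lemma border_state_label_lt v : 0 < v <= n -> border_state (label v) (odd v) < v.
Proof.
case: v => // v /= lt_vn; case: border_stateP => // i lt_in /size_suffix.
rewrite !size_takel ?(ltnW lt_in) ?(ltnW lt_vn) // ltnS leq_eqVlt => /predU1P[->|//].
by case: (odd v).
Qed.

Lemma suffix_take_rcons k u x : k < n ->
  suffix (take k.+1 w) (rcons u x) = (nth x w k == x) && suffix (take k w) u.
Proof. by move=> lt_kn; rewrite (take_nth x) // suffix_rcons. Qed.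

(** A nonempty prefix ending [rcons u x] prolongs one of the other parity ending [u]; the label,
    being the longest of that parity, retains it. *)
Lemma border_state_rcons_label u e x :
  border_state (rcons (label (border_state u e)) x) (~~ e) =
  border_state (rcons u x) (~~ e).
Proof.
apply: eq_bigl => -[[|k] lt_kn] /=; first by rewrite take0 !suffix0s.
rewrite !suffix_take_rcons ?(ltnW lt_kn) //; case: eqP => //= _.
rewrite (inj_eq negb_inj); case: eqP => [ok|]; last by rewrite !andbF.
rewrite !andbT; apply/idP/idP => sk.
  exact: suffix_trans sk (suffix_label_border_state u e).
have := border_state_gt u k (ltnW lt_kn) sk; rewrite ok => lt_k.
apply: suffix_of_suffixes sk (suffix_label_border_state u e) _.
rewrite !size_takel ?(ltnW (ltnW lt_kn)) //.
  by rewrite -ltnS prednK // (leq_trans _ lt_k).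
by rewrite (leq_trans (leq_pred _)) ?border_state_le.
Qed.

Lemma border_state_suffix u e : suffix w u -> border_state u e = border_state w e.
Proof.
move=> sw; apply: eq_bigl => i; congr (_ && _); apply/idP/idP => si.
  by apply: suffix_of_suffixes si sw _; rewrite size_takel // ltnW.
exact: suffix_trans si sw.
Qed.

(* Every letter flips the parity of a state, except that the last letter of [w]
   sends [n] to the image of its parent. *)
Definition step (v : nat) (x : Sigma) : nat :=
  let u := rcons (label v) x in
  border_state u (if u == w then ~~ odd n else odd v).

(** At an occurrence of [w] the new parity is independent of [e]: this is the collapse of an
    edge. *)
Lemma step_border_state u e x :
  step (border_state u e) x =
  border_state (rcons u x) (if suffix w (rcons u x) then ~~ odd n else ~~ e).
Proof.
rewrite /step odd_border_state; case: eqP => [Ew|neq_w].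
  have sw : suffix w (rcons u x).
    by rewrite -Ew suffix_rcons eqxx suffix_label_border_state.
  by rewrite sw Ew (border_state_suffix _ _ sw).
rewrite border_state_rcons_label; case: ifP => // sw; congr border_state.
have lt_n : n.-1 < n by rewrite prednK ?size_gt0.
move: sw; rewrite -{1}(take_size w) -[X in take X](prednK size_gt0).
rewrite suffix_take_rcons // => /andP[/eqP Ex sw].
have := border_state_gt u n.-1 lt_n sw.
rewrite -{3}(prednK size_gt0) /= negbK.
(* If n - 1 had parity [e], the vertex would be [n] and its label followed by [x] would be [w].
   Otherwise [~~ e] and [~~ odd n] agree. *)
case: (odd n.-1 =P e) => [->|]; last by case: (odd n.-1) e {neq_w} => [] [].
rewrite prednK ?size_gt0 // => le_n; case: neq_w.
have ->: border_state u e = n by apply/eqP; rewrite eqn_leq border_state_le.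
by rewrite /label -{1}Ex -take_nth // prednK ?size_gt0 // take_size.
Qed.

Lemma step_le v x : step v x <= n. Proof. exact: border_state_le. Qed.

(** The new prefix has length at most [v]: length [v] would need [x] to prolong the label, and
    [v.-1] has the wrong parity. *)
Lemma step_lt v x : 0 < v <= n -> nth x w v.-1 != x -> step v x < v.
Proof.
case: v => // v /= lt_vn neq_x; rewrite /step /label /=.
have ->: (rcons (take v w) x == w) = false.
  apply: contraNF neq_x => /eqP Ew; rewrite -Ew nth_rcons size_takel ?(ltnW lt_vn) //.
  by rewrite ltnn eqxx.
case: border_stateP => // i lt_in si oi.
have le_iv : i <= v.+1.
  by have := size_suffix si; rewrite size_rcons !size_takel // ltnW.
rewrite ltnS ltn_neqAle; apply/andP; split.
  by apply: contra_eq_neq oi => ->; case: (odd v).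
case: i lt_in si le_iv oi => // i lt_in; rewrite suffix_take_rcons ?(ltnW lt_in) //.
case/andP=> /eqP Ex _; rewrite ltnS leq_eqVlt => /predU1P[Ei|//].
by rewrite -Ei Ex eqxx in neq_x.
Qed.

Lemma step0 x : nth x w 0 != x -> step 0 x = 1.
Proof.
move=> neq_x; rewrite /step /label take0 /=.
have ->: ([:: x] == w) = false by apply: contraNF neq_x => /eqP <-.
apply/eqP; rewrite eqn_leq (border_state_gt _ 0) ?size_gt0 ?take0 ?suffix0s // andbT.
case: border_stateP => // i lt_in si oi.
have := size_suffix si; rewrite size_takel ?(ltnW lt_in) //=.
by case: i oi {lt_in si} => [|[]].
Qed.

Lemma foldl_border_state u e : ~~ infix w u ->
  foldl step (border_state [::] e) u = border_state u (e (+) odd (size u)).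
Proof.
elim/last_ind: u => [|u x IHu]; first by rewrite addbF.
rewrite infix_rconsl negb_or => /andP[/negbTE nsw /IHu Eu].
by rewrite foldl_rcons Eu step_border_state nsw size_rcons addbN.
Qed.

(* The two states are the endpoints of a tree edge, and remain so until an
   occurrence of [w] merges them. *)
Lemma foldl_border_state_merge s e u : u != [::] -> suffix w (s ++ u) ->
  foldl step (border_state s e) u = foldl step (border_state s (~~ e)) u.
Proof.
move=> u_neq0 sw.
suff: foldl step (border_state s e) u = foldl step (border_state s (~~ e)) u \/
    ((u == [::]) || ~~ suffix w (s ++ u)) /\
    (forall d, foldl step (border_state s d) u
               = border_state (s ++ u) (d (+) odd (size u))).
  by rewrite (negbTE u_neq0) sw => -[|[]].
elim/last_ind: u {u_neq0 sw} => [|u x IHu].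
  by right; rewrite cats0; split=> // d; rewrite addbF.
rewrite !foldl_rcons; case: IHu => [->|[_ Eu]]; first by left.
rewrite !Eu !step_border_state rcons_cat.
case: ifP => sw; [by left | right; rewrite orbT; split=> // d].
by rewrite foldl_rcons Eu step_border_state rcons_cat sw size_rcons addbN.
Qed.

(** Descent to the root 0: [w] merges each vertex with its parent, which is smaller. *)
Lemma foldl_step_w v : v <= n -> foldl step v w = foldl step 0 w.
Proof.
elim/ltn_ind: v => -[//|v] IHv lt_vn.
have lt_t := border_state_label_lt v.+1 lt_vn.
rewrite -(IHv _ lt_t (border_state_le _ _)) -{1}(border_state_label v.+1 lt_vn).
by rewrite foldl_border_state_merge ?negbK ?suffix_suffix.
Qed.

Lemma foldl_step_eq u :
  (forall p q, p <= n -> q <= n -> foldl step p u = foldl step q u) <-> infix w u.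
Proof.
split=> [sync|/infixP[s [t ->]] p q le_p le_q].
  (* As long as [w] does not occur, the ends of e_0 keep opposite colours. *)
  apply: contraT => /foldl_border_state Eu.
  have := sync _ _ (border_state_le [::] true) (border_state_le [::] false).
  by rewrite !Eu => /(congr1 odd); rewrite !odd_border_state; case: odd.
rewrite !foldl_cat; congr foldl.
have le_foldl v r : v <= n -> foldl step v r <= n.
  by elim: r v => //= x r IHr v _; apply/IHr/step_le.
by rewrite !(foldl_step_w (foldl _ _ _)) ?le_foldl.
Qed.

(** The label is shorter than [w], so no collapse occurs while it is read. *)
Lemma foldl_step_label v : v <= n -> 0 < v -> foldl step 1 (label v) = v.
Proof.
move=> le_vn v_gt0; rewrite -{1}(border_state_label 1 size_gt0) /label take0.
have lt_v : v.-1 < n by rewrite prednK.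
rewrite foldl_border_state.
  rewrite size_takel ?(ltnW lt_v) // -[RHS](border_state_label v le_vn).
  by congr border_state; rewrite -[in RHS](prednK v_gt0) /= negbK.
apply/negP => /size_infix; rewrite size_takel ?(ltnW lt_v) //.
by rewrite leqNgt lt_v.
Qed.

(** All paths go through 0: mismatching letters descend to it, and a letter other than the first of
    [w] leads from 0 to 1, where labels can be read. *)
Lemma step_connected : (forall x : Sigma, exists y, x != y) ->
  forall p q, p <= n -> q <= n -> exists u, foldl step p u = q.
Proof.
move=> other.
have [x0 _] : exists x0, x0 \in w.
  by case: w w_neq0 => // x s _; exists x; rewrite mem_head.
have [y neq_y] := other (nth x0 w 0).
have nthy v z : v < n -> nth x0 w v != z -> nth z w v != z.
  by move=> lt_v; rewrite (set_nth_default x0).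
have E01 : step 0 y = 1 by apply/step0/nthy/neq_y; exact: size_gt0.
have E10 : step 1 y = 0.
  have := step_lt 1 y size_gt0 (nthy _ _ size_gt0 neq_y).
  by rewrite ltnS leqn0 => /eqP.
have to0 p : p <= n -> exists u, foldl step p u = 0.
  elim/ltn_ind: p => -[_ _|p IHp lt_p]; first by exists [::].
  have [z neq_z] := other (nth x0 w p).
  have [u Eu] := IHp _ (step_lt p.+1 z lt_p (nthy _ _ lt_p neq_z)) (step_le _ _).
  by exists (z :: u).
have from0 q : q <= n -> exists u, foldl step 0 u = q.
  case: q => [_|q le_q]; first by exists [::].
  by exists (y :: label q.+1); rewrite /= E01 foldl_step_label.
move=> p q /to0[u Eu] /from0[v Ev].
by exists (u ++ v); rewrite foldl_cat Eu.
Qed.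

Definition step_ord (v : 'I_n.+1) (x : Sigma) : 'I_n.+1 :=
  Ordinal (step_le v x : step v x < n.+1).

Lemma ord_state_nonempty : 0 < #|'I_n.+1|. Proof. by rewrite card_ord. Qed.

Definition principal_dfa : dfa Sigma := Dfa step_ord ord_state_nonempty.

Lemma val_run (v : 'I_n.+1) u :
  val (@run _ principal_dfa v u) = foldl step v u.
Proof. by rewrite /run; elim: u v => //= x u IHu v; rewrite IHu. Qed.

Lemma Syn_principal_dfa u : (u \in Syn principal_dfa) = infix w u.
Proof.
apply/idP/idP => [/forallP sync|].
  apply/foldl_step_eq => p q le_p le_q.
  have /eqP := forallP (sync (Ordinal (le_p : p < n.+1))) (Ordinal (le_q : q < n.+1)).
  by move/(congr1 val); rewrite !val_run.
move/foldl_step_eq => sync; apply/forallP => p; apply/forallP => q.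
by apply/eqP/val_inj; rewrite !val_run; apply: sync; rewrite -ltnS.
Qed.

End Construction.

Theorem mainTheorem2 (Sigma : finType) (a b : Sigma) (hab : a != b)
    (hSigma : [set: Sigma] = [set a; b])
    (w : seq Sigma) (n : nat) (hw : w <> [::]) (hn : size w = n) :
  exists B : dfa Sigma,
    [/\ strongly_connected B,
        synchronizing B,
        #|state B| = n.+1
      & forall u : seq Sigma,
          u \in Syn B <-> exists s t : seq Sigma, u = s ++ w ++ t].
Proof.
have w_neq0 : w != [::] by apply/eqP.
exists (principal_dfa _ w); split.
- move=> p q _.
  have other (x : Sigma) : exists y, x != y.
    by case: (eqVneq x a) => [->|]; [exists b | exists a].
  have [u Eu] := step_connected _ _ w_neq0 other p q (ltn_ord p) (ltn_ord q).
  by exists u; apply/val_inj; rewrite val_run.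
- by exists w; rewrite Syn_principal_dfa // infix_refl.
- by rewrite card_ord hn.
- by move=> u; rewrite Syn_principal_dfa //; split=> /infixP.
Qed.
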